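(* Let $k\geq 1$, $n\geq 1$, and let $c_n^{(k)}$ denote the number of $k$-tours on trees with $n+1$ vertices. Then \[ c_n^{(k)} = \sum_{\ell=1}^{n}\ \sum_{(n_0,n_1,\dots,n_{n-1})\in T_n(\ell)} \frac{\ell}{n}\binom{n}{n_0,n_1,\dots,n_{n-1}}\,\frac{1}{\ell!}\,\frac{(\ell k)!}{(k!)^{\ell}}\ \prod_{i\geq 1}\left(\frac{1}{(i+1)!}\,\frac{((i+1)k)!}{(k!)^{i+1}}\right)^{n_i}, \] where $T_n(\ell)=\{(n_0,n_1,\dots,n_{n-1})\in \mathbb{Z}_{\geq 0}^{n} : \sum_{i=0}^{n-1} n_i = n,\ \sum_{i=0}^{n-1} i\,n_i = n-\ell\}$ and $\binom{n}{n_0,n_1,\dots}$ is the multinomial coefficient.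
   Context: A $k$-tour on a tree with $n+1$ vertices is a closed walk $W=(v_1,v_2,\dots,v_{2kn},v_1)$ on the complete graph with vertex set $\{1,\dots,n+1\}$ such that $v_1=1$, the vertices appear for the first time in the order $1,2,\dots,n+1$, the graph $T(W)$ on $\{1,\dots,n+1\}$ whose edges are the pairs $\{v_i,v_{i+1}\}$ (indices cyclic) is a tree, and every edge of $T(W)$ is traversed by $W$ exactly $k$ times in each direction ($2k$ times in total). *)

(* Defs.v *)
From mathcomp Require Import all_boot all_order all_algebra.
From mathcomp Require Import boolp.
Set Implicit Arguments. Unset Strict Implicit. Unset Printing Implicit Defensive.
Import Order.TTheory GRing.Theory Num.Theory.

(* Vertices {1,...,n+1} are represented by 'I_(n+1), vertex j+1 <-> j.
   A closed walk of length m = 2kn is W : {ffun 'I_m -> 'I_(n+1)},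
   W i = v_(i+1); the step after position i goes to position ordS i (cyclic). *)

Definition walk_adj (m N : nat) (W : {ffun 'I_m -> 'I_N}) : rel 'I_N :=
  fun x y => [exists i : 'I_m,
     ((W i == x) && (W (ordS i) == y)) || ((W i == y) && (W (ordS i) == x))].

Definition traversals (m N : nat) (W : {ffun 'I_m -> 'I_N}) (x y : 'I_N) : nat :=
  #|[set i : 'I_m | (W i == x) && (W (ordS i) == y)]|.

(* A (simple) graph given by a symmetric relation on a finite type is a tree:
   connected and without cycles (a cycle = closed path through >= 3
   pairwise distinct vertices). *)
Definition is_tree (T : finType) (e : rel T) : Prop :=
  (forall x y : T, connect e x y) /\
  (forall s : seq T, uniq s -> 3 <= size s -> ~~ cycle e s).

Definition is_ktour (k n : nat) (W : {ffun 'I_(2 * k * n) -> 'I_n.+1}) : Prop :=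
  (forall i, W i != W (ordS i)) /\
  (exists h : 0 < 2 * k * n, W (Ordinal h) = ord0) /\
  (forall j : 'I_n.+1, j \in fgraph W) /\
  (forall j j' : 'I_n.+1, (j < j')%N -> (index j (fgraph W) < index j' (fgraph W))%N) /\
  is_tree (walk_adj W) /\
  (forall x y : 'I_n.+1, walk_adj W x y -> traversals W x y = k /\ traversals W y x = k).

Definition num_ktours (k n : nat) : nat :=
  #|[set W : {ffun 'I_(2 * k * n) -> 'I_n.+1} | `[< @is_ktour k n W >] ]|.

(* the set T_n(l) of (n_0,...,n_(n-1)) with sum n_i = n, sum i n_i = n - l;
   each n_i <= n so the tuples are taken in {ffun 'I_n -> 'I_n.+1} *)
Definition Tset (n l : nat) : {set {ffun 'I_n -> 'I_n.+1}} :=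
  [set t : {ffun 'I_n -> 'I_n.+1} | ((\sum_(i < n) (t i : nat)) == n) && ((\sum_(i < n) i * t i) == n - l)]%N.

Local Open Scope ring_scope.

Definition multinom (n : nat) (t : {ffun 'I_n -> 'I_n.+1}) : rat :=
  (n`!)%:R / \prod_(i < n) ((t i)`!)%:R.

Definition rhs (k n : nat) : rat :=
  \sum_(1 <= l < n.+1) \sum_(t in Tset n l)
    (l%:R / n%:R) * multinom t * (l`!)%:R^-1 * ((l * k)`!)%:R / ((k`!)%:R ^+ l)
    * \prod_(i < n | (1 <= i)%N)
        (((i.+1)`!)%:R^-1 * ((i.+1 * k)`!)%:R / ((k`!)%:R ^+ i.+1)) ^+ t i.

(* Main.v *)
Require Import Defs.
From mathcomp Require Import all_boot all_order all_algebra perm fingroup.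
From mathcomp Require Import boolp.
From mathcomp Require Import zify ring.

Set Implicit Arguments. Unset Strict Implicit. Unset Printing Implicit Defensive.

Import GRing.Theory Num.Theory.

(** Dropping the condition on the order of first visits multiplies the number of
    tours by [n!], since the relabellings fixing the root act freely.  For the
    remaining closed walks we prescribe the degree [d x] of every vertex.  Some
    [v] other than the root is then a leaf, with one neighbour [u].  Deleting its
    [k] visits leaves a tour with one vertex less, and the [k] detours [u v u] can
    be put back at the visits to [u] in [C(k (d u - 1) + k - 1, k)] ways (with one
    more place at the root, where the walk both starts and ends).  By induction
    the number of tours with degrees [d] is a product of local weights times
    [(n-1)! / prod_x (d x - 1)!].  Summing over the degree sequences, grouped by
    the number of vertices of each degree, yields the formula.  The tree condition
    follows from the other ones, again by deleting leaves. *)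

(** * Counting the elements that satisfy a predicate *)

(* Rational-valued, so that cardinalities can be given by formulas with divisions. *)
Definition counted {A : eqType} (P : A -> Prop) (N : rat) : Prop :=
  exists L : seq A, [/\ uniq L, ((size L)%:R = N)%R & forall a, a \in L <-> P a].

Lemma counted_ext (A : eqType) (P Q : A -> Prop) (N : rat) :
  (forall a, P a <-> Q a) -> counted P N -> counted Q N.
Proof.
move=> PQ [L [uL sL PL]]; exists L; split=> // a.
by rewrite PL; apply: PQ.
Qed.

Lemma counted0 (A : eqType) (P : A -> Prop) :
  (forall a, ~ P a) -> counted P 0%R.
Proof. by move=> nP; exists [::]; split=> // a; split=> // /nP. Qed.

Lemma counted1 (A : eqType) (b : A) : counted (fun a => a = b) 1%R.
Proof.
by exists [:: b]; split=> // a; rewrite inE; split=> [/eqP|->].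
Qed.

Lemma countedU (A : eqType) (P Q : A -> Prop) (M N : rat) :
  (forall a, P a -> ~ Q a) -> counted P M -> counted Q N ->
  counted (fun a => P a \/ Q a) (M + N)%R.
Proof.
move=> dPQ [L [uL sL PL]] [K [uK sK QK]]; exists (L ++ K); split.
- rewrite cat_uniq uL uK andbT; apply/hasPn => a /QK Qa.
  by apply/negP => /PL /dPQ.
- by rewrite size_cat natrD sL sK.
- move=> a; rewrite mem_cat; split.
    by case/orP=> [/PL|/QK]; [left|right].
  by case=> [/PL|/QK] ->; rewrite ?orbT.
Qed.

Lemma counted_image (A B : eqType) (f : A -> B) (P : A -> Prop) (N : rat) :
  (forall a b, P a -> P b -> f a = f b -> a = b) -> counted P N ->
  counted (fun b => exists2 a, P a & b = f a) N.
Proof.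
move=> injf [L [uL sL PL]]; exists (map f L); split.
- rewrite map_inj_in_uniq // => a b /PL Pa /PL Pb; exact: injf.
- by rewrite size_map.
- move=> b; split=> [/mapP[a /PL Pa ->]|[a /PL La ->]]; first by exists a.
  by apply/mapP; exists a.
Qed.

Lemma counted_sum (I A : eqType) (r : seq I) (P : I -> A -> Prop) (N : I -> rat) :
  uniq r -> (forall i, i \in r -> counted (P i) (N i)) ->
  (forall i j a, i \in r -> j \in r -> P i a -> P j a -> i = j) ->
  counted (fun a => exists2 i, i \in r & P i a) (\sum_(i <- r) N i)%R.
Proof.
elim: r => [|i r IH] /= => [_ _ _|/andP[ir ur] cP dP].
  by rewrite big_nil; apply: counted0 => a [].
rewrite big_cons.
apply: (@counted_ext _ (fun a => P i a \/ exists2 j, j \in r & P j a)).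
  move=> a; split=> [[Pa|[j jr Pa]]|[j]].
  - by exists i; rewrite ?mem_head.
  - by exists j; rewrite ?inE ?jr ?orbT.
  - by rewrite inE => /orP[/eqP->|jr] Pa; [left|right; exists j].
apply: countedU.
- move=> a Pa [j jr Pja]; move: ir; rewrite (dP i j a) ?jr //.
    by rewrite mem_head.
  by rewrite inE jr orbT.
- by apply: cP; rewrite mem_head.
- apply: IH => // [j jr|j j' a jr j'r]; first by apply: cP; rewrite inE jr orbT.
  by apply: dP; rewrite inE ?jr ?j'r orbT.
Qed.

(** Fibres of constant size [N], disjoint because [R] determines the base point. In the application
    every smaller tour has equally many extensions. *)
Lemma counted_fibers (A B : eqType) (R : B -> A -> Prop) (Q : B -> Prop)
    (M N : rat) :
  counted Q M -> (forall b, Q b -> counted (R b) N) ->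
  (forall a b b', R b a -> R b' a -> b = b') ->
  counted (fun a => exists2 b, Q b & R b a) (M * N)%R.
Proof.
move=> [L [uL <- QL]] cR funR.
have -> : ((size L)%:R * N = \sum_(b <- L) N)%R.
  by rewrite big_const_seq count_predT iter_addr_0 mulr_natl.
apply: (@counted_ext _ (fun a => exists2 b, b \in L & R b a)).
  by move=> a; split=> -[b /QL Qb Rba]; exists b.
by apply: counted_sum => [|b /QL /cR|b c a _ _ Rb Rc] //; apply: funR Rb Rc.
Qed.

Lemma counted_inj (A : eqType) (P : A -> Prop) (M N : rat) :
  counted P M -> counted P N -> M = N.
Proof.
move=> [L [uL <- PL]] [K [uK <- PK]]; congr (_%:R)%R; apply: perm_size.
by apply: uniq_perm => // a; apply/idP/idP=> [/PL/PK|/PK/PL].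
Qed.

Lemma counted_card (T : finType) (A : {set T}) : counted (fun a => a \in A) (#|A|)%:R.
Proof.
exists (enum A); split; rewrite ?enum_uniq ?cardE // => a.
by rewrite mem_enum.
Qed.

Lemma counted0_inv (A : eqType) (P : A -> Prop) (a : A) :
  counted P 0%R -> ~ P a.
Proof.
move=> [L [_ /eqP + PL]] /PL; rewrite pnatr_eq0 size_eq0 => /eqP ->.
by rewrite in_nil.
Qed.

(** * Attaching a leaf *)

(* A walk that starts at [x] is encoded by [x] and the list [s] of its subsequent
   vertices; a closed walk at [r] thus has [last r s = r]. *)
Definition steps {T : Type} (x : T) (s : seq T) : seq (T * T) := zip (x :: s) s.

(* [ins u v x s s0]: the walk [x :: s] arises from [x :: s0], which avoids [v], by
   inserting detours [v, u] after visits to [u]. *)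
Inductive ins {T : eqType} (u v : T) : T -> seq T -> seq T -> Prop :=
| ins_nil x : ins u v x [::] [::]
| ins_cons x y s s0 : y != v -> ins u v y s s0 -> ins u v x (y :: s) (y :: s0)
| ins_detour s s0 : ins u v u s s0 -> ins u v u [:: v, u & s] s0.

Lemma ins_notin (T : eqType) (u v x : T) (s s0 : seq T) :
  ins u v x s s0 -> v \notin s0.
Proof. by elim=> // {}x y {}s {}s0 yv _ IH; rewrite inE eq_sym negb_or yv. Qed.

Lemma ins_last (T : eqType) (u v x : T) (s s0 : seq T) :
  ins u v x s s0 -> last x s = last x s0.
Proof. by elim. Qed.

(** Each detour brings one arrival at [v] and one at [u], so [count_mem v s] is the number of
    detours. *)
Lemma ins_count (T : eqType) (u v x y : T) (s s0 : seq T) :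
  u != v -> ins u v x s s0 ->
  count_mem y s = count_mem y s0 + ((y == u) + (y == v)) * count_mem v s.
Proof.
move=> uv; elim=> [||{}s {}s0 _ /= ->] /=; first by rewrite muln0.
  by move=> _ z {}s {}s0 /negPf zv _ ->; rewrite zv !add0n addnA.
rewrite eqxx (negPf uv) add0n add1n (eq_sym v) (eq_sym u) mulnS; lia.
Qed.

(** A detour starts and ends at [u]. It therefore adds one step in each direction between [u] and
    [v] and keeps all other steps. *)
Lemma ins_steps (T : eqType) (u v x a b : T) (s s0 : seq T) :
  u != v -> ins u v x s s0 ->
  count_mem (a, b) (steps x s) = count_mem (a, b) (steps x s0)
    + (((a, b) == (u, v)) + ((a, b) == (v, u))) * count_mem v s.
Proof.
move=> uv; elim=> [||{}s {}s0 _] /=; first by rewrite muln0.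
  by move=> {}x z {}s {}s0 /negPf zv _; rewrite /steps /= zv => ->; rewrite !add0n addnA.
rewrite /steps /= => ->.
rewrite eqxx (negPf uv) add0n add1n (eq_sym (u, v)) (eq_sym (v, u)) mulnS; lia.
Qed.

Lemma insP (T : eqType) (u v x : T) (s s0 : seq T) :
  ins u v x s s0 <->
  [\/ s = [::] /\ s0 = [::],
      exists y s' s0', [/\ y != v, s = y :: s', s0 = y :: s0' & ins u v y s' s0']
    | exists2 s', x = u /\ s = [:: v, u & s'] & ins u v u s' s0].
Proof.
split=> [|[[-> ->]|[y [s' [s0' [yv -> -> i]]]]|[s' [-> ->] i]]]; try by constructor.
case=> [{}x|{}x y s' s0' yv i|s' s0' i].
- by constructor 1.
- by constructor 2; exists y, s', s0'.
- by constructor 3; exists s'.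
Qed.

(** The detours can be read off from [s]: a letter [v] always opens one, since ordinary steps avoid
    [v]. *)
Lemma ins_functional (T : eqType) (u v x : T) (s s0 s1 : seq T) :
  ins u v x s s0 -> ins u v x s s1 -> s0 = s1.
Proof.
move=> i; elim: i s1 => {x s s0} [x|x y s s0 yv _ IH|s s0 _ IH] s1 /insP.
- by case=> [[]|[? [? [? []]]]|[? []]].
- case=> [[]|[? [? [? [_ [<- <-] -> /IH ->]]]]|[? [_ [E]]]] //.
  by rewrite E eqxx in yv.
- case=> [[]|[y [? [? [yv [E]]]]]|[? [_ [<-] /IH]]] //.
  by rewrite E eqxx in yv.
Qed.

Lemma ins_exists (T : eqType) (u v x : T) (s : seq T) :
  last x s != v -> x != v ->
  (forall y, (y, v) \in steps x s -> y = u) ->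
  (forall y, (v, y) \in steps x s -> y = u) ->
  exists s0, ins u v x s s0.
Proof.
(* Strong induction on the length, as removing a detour takes away two letters. *)
have [n] := ubnP (size s); elim: n x s => // n IH x [|y s] /=.
  by move=> *; exists [::]; constructor.
rewrite ltnS => sn ls xv uv vu.
have [yv|yv] := eqVneq y v; last first.
  have [|||||s0 i] := IH y s => //.
  - by move=> z zi; apply: uv; rewrite /steps /= inE zi orbT.
  - by move=> z zi; apply: vu; rewrite /steps /= inE zi orbT.
  by exists (y :: s0); constructor.
subst y; have xu : x = u by apply: uv; rewrite /steps /= mem_head.
case: s sn ls uv vu => [|z s] /= sn ls uv vu; first by rewrite eqxx in ls.
have zu : z = u by apply: vu; rewrite /steps /= !inE eqxx orbT.
subst x z; have [|||||s0 i] := IH u s => //.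
- exact: ltnW.
- by move=> z zi; apply: uv; rewrite /steps /= !inE zi !orbT.
- by move=> z zi; apply: vu; rewrite /steps /= !inE zi !orbT.
by exists s0; constructor.
Qed.

(** Stars and bars: [k] equal detours are distributed over the visits to [u] in [x :: s0],
    repetitions allowed. If there is no such visit, truncated subtraction still gives the right
    values, 1 for [k = 0] and 0 otherwise. *)
Lemma counted_ins (T : eqType) (u v x : T) (s0 : seq T) (k : nat) :
  u != v -> x != v -> v \notin s0 ->
  counted (fun s => ins u v x s s0 /\ count_mem v s = k)
    ('C(count_mem u (x :: s0) + k - 1, k))%:R%R.
Proof.
move=> uv; elim: s0 x k => [|y s0 IH] x k xv.
  move=> _; have [xu|xu] := eqVneq x u.
    rewrite /= xu eqxx addn0 addKn binn.
    elim: k => [|k IHk].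
      apply: (@counted_ext _ (fun s => s = [::])); last exact: counted1.
      move=> s; split=> [->|[/insP[[]//|[? [? [? []]]]//|[s' [_ ->] _ /=]]]].
        by split=> //; constructor.
      by rewrite eqxx.
    apply: counted_ext (counted_image (f := fun s => [:: v, u & s]) _ IHk); last first.
      by move=> a b _ _ [].
    move=> s; split=> [[s' [i <-] ->]|[/insP[[->]//|[? [? [? []]]]//|[s' [_ ->] i]]]].
      by split=> /=; [constructor|rewrite eqxx (negPf uv)].
    rewrite /= eqxx (negPf uv) => -[<-]; by exists s'.
  rewrite /= (negPf xu); case: k => [|k]; last first.
    rewrite bin_small; last by lia.
    apply: counted0 => s [/insP[[->]//|[? [? [? []]]]//|[s' [E]]]].
    by rewrite E eqxx in xu.
  apply: (@counted_ext _ (fun s => s = [::])); last exact: counted1.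
  move=> s; split=> [->|[/insP[[]//|[? [? [? []]]]//|[s' [E]]]]].
    by split=> //; constructor.
  by rewrite E eqxx in xu.
rewrite inE negb_or eq_sym => /andP[yv vs0].
have cy m : counted (fun s => exists2 s', ins u v y s' s0 /\ count_mem v s' = m & s = y :: s')
    ('C(count_mem u (y :: s0) + m - 1, m))%:R%R.
  by apply: counted_image; [move=> a b _ _ []|exact: IH].
have [xu|xu] := eqVneq x u; last first.
  move: (cy k); rewrite [count_mem u (x :: _)]/= (negPf xu) add0n.
  apply: counted_ext => s; split.
    by case=> s' [i c] ->; split=> /=; [constructor|rewrite (negPf yv)].
  case=> /insP[[]//|[? [s' [? [_ -> [<- <-] i]]]] /=|[? [E]]].
    by rewrite (negPf yv) => c; exists s'.
  by rewrite E eqxx in xu.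
subst x; elim: k => [|k IHk].
  rewrite bin0; move: (cy 0); rewrite bin0.
  apply: counted_ext => s; split.
    by case=> s' [i c] ->; split=> /=; [constructor|rewrite (negPf yv)].
  case=> /insP[[]//|[? [s' [? [_ -> [<- <-] i]]]] /=|[? [_ ->]] _ /=].
    by rewrite (negPf yv) => c; exists s'.
  by rewrite eqxx.
(* Pascal's rule mirrors the choice at a visit to [u]: either go on to [y], or make one detour and
   face the same choice with one detour less. *)
have -> : ('C(count_mem u [:: u, y & s0] + k.+1 - 1, k.+1)%:R%R : rat) =
  ('C(count_mem u (y :: s0) + k.+1 - 1, k.+1)%:R + 'C(count_mem u [:: u, y & s0] + k - 1, k)%:R)%R.
  rewrite -[count_mem u [:: u, y & s0]]/((u == u) + count_mem u (y :: s0)) eqxx.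
  set c := count_mem _ _.
  have -> : 1 + c + k.+1 - 1 = (c + k).+1 by lia.
  have -> : c + k.+1 - 1 = c + k by lia.
  have -> : 1 + c + k - 1 = c + k by lia.
  by rewrite binS natrD.
have cd : counted (fun s => exists2 s', ins u v u s' (y :: s0) /\ count_mem v s' = k & s = [:: v, u & s'])
    ('C(count_mem u [:: u, y & s0] + k - 1, k))%:R%R.
  by apply: counted_image IHk => a b _ _ [].
apply: counted_ext (countedU _ (cy k.+1) cd).
  move=> s; split=> [[[s' [i c] ->]|[s' [i c] ->]]|].
  - by split=> /=; [constructor|rewrite (negPf yv)].
  - by split=> /=; [constructor|rewrite eqxx (negPf uv) c].
  case=> /insP[[]//|[? [s' [? [_ -> [<- <-] i]]]] /=|[s' [_ ->] i] /=].
    by rewrite (negPf yv) => c; left; exists s'.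
  by rewrite eqxx (negPf uv) => -[c]; right; exists s'.
move=> s [s' _ ->] [s'' _ [E]]; by rewrite E eqxx in yv.
Qed.

(* Each visit count [k * d x] is a count of arrivals, so it includes the return to
   the root but not the start, and [d x] is the degree of [x]. *)
Definition tour {T : eqType} (k : nat) (r : T) (d : T -> nat) (s : seq T) : Prop :=
  [/\ last r s = r, forall x, count_mem x s = k * d x,
      forall x, (x, x) \notin steps r s
    & forall x y, (x, y) \in steps r s ->
        count_mem (x, y) (steps r s) = k /\ count_mem (y, x) (steps r s) = k].

Lemma mem_steps (T : eqType) (x a b : T) (s : seq T) :
  (a, b) \in steps x s -> (a \in x :: s) /\ (b \in s).
Proof.
elim: s x => // y s IH x; rewrite /steps /= inE => /orP[/eqP[-> ->]|/IH[ai bi]].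
  by rewrite eqxx mem_head.
by rewrite ai orbT inE bi orbT.
Qed.

Lemma mem_count (T : eqType) (x : T) (s : seq T) : (x \in s) = (0 < count_mem x s).
Proof. by rewrite -has_count has_pred1. Qed.

Lemma count_steps2 (T : eqType) (x v : T) (s : seq T) :
  count_mem v s = count (fun p => p.2 == v) (steps x s).
Proof. by elim: s x => // y s IH x; rewrite /steps /= (IH y). Qed.

(** The [k] detours amount to [k] steps each way along the new edge between [u] and [v]. No other
    step count changes, so the balance of all other edges is preserved in both directions. *)
Lemma ins_tour (T : eqType) (k : nat) (r u v : T) (d d' : T -> nat) (s s0 : seq T) :
  0 < k -> u != v -> r != v ->
  (forall x, d x = d' x + ((x == u) + (x == v))) ->
  ins u v r s s0 -> count_mem v s = k ->
  tour k r d s <-> tour k r d' s0.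
Proof.
move=> k0 uv rv dd' i cv.
have vs0 := ins_notin i.
have st a b : count_mem (a, b) (steps r s) = count_mem (a, b) (steps r s0)
    + (((a, b) == (u, v)) + ((a, b) == (v, u))) * k by rewrite (ins_steps _ _ uv i) cv.
have vrs0 : v \notin r :: s0 by rewrite inE negb_or eq_sym rv.
(* Steps of [s0] do not touch [v], so the correction term in [st] vanishes on them. *)
have n1 x y : (x, y) \in steps r s0 -> ((x, y) == (u, v)) + ((x, y) == (v, u)) = 0.
  move=> /mem_steps[xi yi]; rewrite !xpair_eqE.
  case: (eqVneq y v) yi vs0 => [-> ->|_ _ _] //; rewrite andbF.
  by case: (eqVneq x v) xi vrs0 => [-> ->|].
have n2 x y : (x, y) \in steps r s0 -> ((y, x) == (u, v)) + ((y, x) == (v, u)) = 0.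
  by move=> /n1; rewrite !xpair_eqE addnC ![(y == _) && _]andbC.
have n3 x : ((x, x) == (u, v)) + ((x, x) == (v, u)) = 0.
  by rewrite !xpair_eqE; case: (eqVneq x v) => [->|_]; rewrite ?andbF // (eq_sym v) (negPf uv).
have z1 : count_mem (u, v) (steps r s0) = 0.
  by apply/eqP; rewrite eqn0Ngt -mem_count; apply/negP => /mem_steps[_]; rewrite (negPf vs0).
have z2 : count_mem (v, u) (steps r s0) = 0.
  by apply/eqP; rewrite eqn0Ngt -mem_count; apply/negP => /mem_steps[]; rewrite (negPf vrs0).
have vu : ((u, v) == (v, u)) = false by rewrite xpair_eqE (negPf uv).
have uv' : ((v, u) == (u, v)) = false by rewrite eq_sym.
split=> -[ls cs nl sy]; split.
- by rewrite -(ins_last i).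
- by move=> x; have := cs x; rewrite (ins_count _ uv i) cv dd' mulnDr [_ * k]mulnC => /addIn.
- by move=> x; have := nl x; rewrite !mem_count st n3 addn0.
- move=> x y xy; have := sy x y; rewrite mem_count !st n1 // n2 // !addn0.
  by rewrite -mem_count; apply.
- by rewrite (ins_last i).
- by move=> x; rewrite (ins_count _ uv i) cv dd' mulnDr [_ * k]mulnC cs.
- by move=> x; have := nl x; rewrite !mem_count st n3 addn0.
- move=> x y.
  have [[-> ->]|xu] := eqVneq (x, y) (u, v).
    by rewrite !st z1 z2 !eqxx vu uv' mul1n.
  have [[-> ->]|xv] := eqVneq (x, y) (v, u).
    by rewrite !st z1 z2 !eqxx vu uv' mul1n.
  move=> xys; have xy : (x, y) \in steps r s0.
    by move: xys; rewrite !mem_count st (negPf xu) (negPf xv) addn0.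
  by rewrite !st n1 // n2 // !addn0; exact: sy.
Qed.

(** There are only [k] arrivals at [v], and a step into [v] that occurs at all occurs [k] times;
    hence it always comes from the same [u]. By the balance of the steps every departure from [v]
    goes back to [u]. *)
Lemma tour_leaf (T : eqType) (k : nat) (r v : T) (d : T -> nat) (s : seq T) :
  0 < k -> r != v -> d v = 1 -> tour k r d s ->
  exists u, [/\ u != v, 0 < d u, (forall y, (y, v) \in steps r s <-> y = u)
                & (forall y, (v, y) \in steps r s <-> y = u)
                 /\ exists s0, ins u v r s s0].
Proof.
move=> k0 rv dv [ls cs nl sy].
have cv : count_mem v s = k by rewrite cs dv muln1.
have [u uvi] : exists u, (u, v) \in steps r s.
  have : has (fun p => p.2 == v) (steps r s) by rewrite has_count -count_steps2 cv.
  by case/hasP=> -[u w] wi /= /eqP Ew; exists u; rewrite -Ew.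
have uniq_u y : (y, v) \in steps r s -> y = u.
  move=> yvi; apply/eqP; apply: contraT => yu.
  have := count_steps2 r v s; rewrite cv.
  have [cy _] := sy _ _ yvi; have [cu _] := sy _ _ uvi.
  (* A second source [y] would give [2 * k] arrivals at [v]. *)
  have : count (predU (pred1 (y, v)) (pred1 (u, v))) (steps r s)
         <= count (fun p => p.2 == v) (steps r s).
    by apply: sub_count => p /orP[] /eqP ->; rewrite /= eqxx.
  have := count_predUI (pred1 (y, v)) (pred1 (u, v)) (steps r s).
  rewrite cy cu (@eq_count _ (predI _ _) pred0) ?count_pred0; first by lia.
  move=> p /=; apply/negP=> /andP[/eqP-> /eqP[E]]; by rewrite E eqxx in yu.
have uv : u != v by apply/negP=> /eqP E; have := nl v; rewrite -{1}E uvi.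
have vui : (v, u) \in steps r s by rewrite mem_count (proj2 (sy _ _ uvi)).
have uniq_u' y : (v, y) \in steps r s -> y = u.
  by move=> vyi; apply: uniq_u; rewrite mem_count (proj2 (sy _ _ vyi)).
exists u; split=> //.
- have [_ /=] := mem_steps vui; rewrite mem_count cs muln_gt0; by case/andP.
- by move=> y; split=> [/uniq_u|->].
- split; first by move=> y; split=> [/uniq_u'|->].
  by apply: ins_exists; rewrite // ls.
Qed.

(** * Tours with prescribed degrees *)

(* The degrees left after deleting a leaf [v] attached to [u]. *)
Definition prune {T : eqType} (v : T) (d : T -> nat) (u x : T) : nat :=
  d x - ((x == u) + (x == v)).

Definition grafted {T : eqType} (k : nat) (r v : T) (d : T -> nat) (u : T)
    (s : seq T) : Prop :=
  exists2 s0, tour k r (prune v d u) s0 & ins u v r s s0 /\ count_mem v s = k.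

Lemma pruneE (T : eqType) (v u : T) (d : T -> nat) (x : T) :
  u != v -> d v = 1 -> 0 < d u -> d x = prune v d u x + ((x == u) + (x == v)).
Proof.
move=> uv dv du; rewrite /prune subnK //.
by have [->|_] := eqVneq x u; [rewrite (negPf uv)|have [->|_] := eqVneq x v; rewrite ?dv].
Qed.

(** Sorts the tours by the neighbour [u] of the leaf [v]. Positivity of [d u] makes the truncated
    subtraction in [prune] exact. *)
Lemma tour_grafted (T : eqType) (k : nat) (r v : T) (d : T -> nat) (s : seq T) :
  0 < k -> r != v -> d v = 1 ->
  tour k r d s <-> exists2 u, (u != v) && (0 < d u) & grafted k r v d u s.
Proof.
move=> k0 rv dv; split=> [ts|[u /andP[uv du] [s0 t0 [i c]]]].
  have [u [uv du _ [_ [s0 i]]]] := tour_leaf k0 rv dv ts.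
  have c : count_mem v s = k by case: ts => _ -> _ _; rewrite dv muln1.
  exists u; rewrite ?uv //; exists s0 => //.
  exact/(ins_tour k0 uv rv (fun x => pruneE x uv dv du) i c).
exact/(ins_tour k0 uv rv (fun x => pruneE x uv dv du) i c).
Qed.

Lemma grafted_functional (T : eqType) (k : nat) (r v : T) (d : T -> nat) (u u' : T)
    (s : seq T) :
  0 < k -> r != v -> d v = 1 -> (u != v) && (0 < d u) -> (u' != v) && (0 < d u') ->
  grafted k r v d u s -> grafted k r v d u' s -> u = u'.
Proof.
move=> k0 rv dv hu hu' g g'.
have ts : tour k r d s by apply/(tour_grafted s k0 rv dv); exists u.
have [w [_ _ ws _]] := tour_leaf k0 rv dv ts.
have gw z : z != v -> grafted k r v d z s -> z = w.
  move=> zv [s0 _ [i c]]; apply/ws; rewrite mem_count (ins_steps _ _ zv i) c.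
  by rewrite eqxx addn_gt0 muln_gt0 k0 andbT addn_gt0 orbT.
by case/andP: hu => /gw/(_ g) -> _; case/andP: hu' => /gw/(_ g') ->.
Qed.

(** The number of places for detours depends on the smaller tour only through the degree of [u]. The
    term [(u == r)] stands for the start of the walk, which is a visit to the root but not an
    arrival. *)
Lemma counted_grafted (T : eqType) (k : nat) (r v : T) (d : T -> nat) (u : T) (q : rat) :
  r != v -> u != v -> counted (tour k r (prune v d u)) q -> d v = 1 ->
  counted (grafted k r v d u) (q * 'C(k * prune v d u u + (u == r) + k - 1, k)%:R)%R.
Proof.
move=> rv uv cq dv; apply: counted_fibers => //.
  move=> s0 [ls cs _ _].
  have vs0 : v \notin s0.
    by rewrite mem_count cs /prune dv eqxx addn1 subSS sub0n muln0.
  have -> : k * prune v d u u + (u == r) = count_mem u (r :: s0).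
    by rewrite /= cs addnC (eq_sym u).
  exact: counted_ins.
by move=> s s0 s1 [i _] [i' _]; apply: ins_functional i i'.
Qed.

(** * Local weights and the recursion over leaves *)

Local Open Scope ring_scope.

(* The orders in which the excursions through the [m] edges at a vertex can be
   interleaved, divided by the factor [(m - 1)!] of the tree count. Away from the root the last departure
   is along the edge towards the root. *)
Definition local_weight (k : nat) (root : bool) (m : nat) : rat :=
  if root then ((k * m)`!)%:R / (k`!%:R ^+ m * (m.-1)`!%:R)
  else ((k * m).-1)`!%:R / ((k.-1)`!%:R * k`!%:R ^+ m.-1 * (m.-1)`!%:R).

Lemma natf_fact (n : nat) : n`!%:R != 0 :> rat.
Proof. by rewrite pnatr_eq0 -lt0n fact_gt0. Qed.

(** The binomial interleaves the excursions through one further edge with those through the [m] old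
    ones; the factor [m] compensates for [(m - 1)!] becoming [m!] in the denominator. *)
Lemma local_weightS (k m : nat) (root : bool) : (0 < k)%N -> (0 < m)%N ->
  local_weight k root m * 'C(k * m + root + k - 1, k)%:R
  = local_weight k root m.+1 * m%:R.
Proof.
move=> k0; case: m => // m _; rewrite /local_weight.
have bin_fact_add a : ('C(a + k, k)%:R * (k`!%:R * a`!%:R) = (a + k)`!%:R :> rat).
  by rewrite -(bin_fact (leq_addl a k)) addnK !natrM.
have := natf_fact k; have := natf_fact m; have := natf_fact k.-1.
have : m.+1%:R != 0 :> rat by rewrite pnatr_eq0.
case: root => /= m1 nk' nm nk.
  have := bin_fact_add (k * m.+1)%N; have := natf_fact (k * m.+1).
  have -> : (k * m.+1 + 1 + k - 1 = k * m.+1 + k)%N by lia.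
  rewrite [(k * m.+2)%N]mulnSr.
  move=> na <-; rewrite factS natrM !exprS; have := expf_neq0 m nk; move: nk m1.
  move: (m.+1%:R : rat) (k`!%:R ^+ m : rat) => c e nk c0 e0; field.
  by rewrite c0 nm nk e0.
have km0 : (0 < k * m.+1)%N by rewrite muln_gt0 k0.
have -> : (k * m.+1 + 0 + k - 1 = (k * m.+1).-1 + k)%N by lia.
have -> : ((k * m.+2).-1 = (k * m.+1).-1 + k)%N by lia.
have := bin_fact_add (k * m.+1).-1; have := natf_fact (k * m.+1).-1.
move=> na <-; rewrite factS natrM !exprS; have := expf_neq0 m nk; move: nk m1.
move: (m.+1%:R : rat) (k`!%:R ^+ m : rat) => c e nk c0 e0; field.
by rewrite c0 nk' nm nk e0.
Qed.

(** The numerical constraints on the degrees of a tree with [n.+1] edges, at least one. The vertices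
    form a subset [V] of a fixed type, so that deleting a leaf does not change the type. *)
Definition tree_degrees {T : finType} (n : nat) (V : {set T}) (r : T)
    (d : T -> nat) : Prop :=
  [/\ #|V| = n.+2, r \in V, forall x, x \notin V -> d x = 0%N,
      forall x, x \in V -> (0 < d x)%N & (\sum_(x in V) d x = 2 * n.+1)%N].

(** If all vertices except [r] had degree at least 2, the degrees would add up to at least
    [2 * n.+1 + 1]. *)
Lemma leaf_exists (T : finType) (n : nat) (V : {set T}) (r : T) (d : T -> nat) :
  tree_degrees n V r d -> exists v, [/\ v \in V, r != v & d v = 1%N].
Proof.
case=> cV rV _ d0 sd.
have [/existsP[v /and3P[vV vr /eqP dv]]|] :=
  boolP [exists v, [&& v \in V, r != v & d v == 1%N]]; first by exists v.
rewrite negb_exists => /forallP nE; exfalso.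
have : (\sum_(x in V | x != r) 2 <= \sum_(x in V | x != r) d x)%N.
  apply: leq_sum => x /andP[xV xr]; have := nE x; have := d0 x xV.
  by rewrite xV eq_sym xr /=; case: (d x) => [|[|]].
have := cardsD1 r V; rewrite cV rV.
move: sd; rewrite (bigD1 r) //= sum_nat_const; have := d0 r rV.
have -> : #|[pred x in V | x != r]| = #|V :\ r|.
  by apply: eq_card => x; rewrite !inE andbC.
lia.
Qed.

Lemma counted_tour_leaf (T : finType) (k : nat) (r v : T) (V : {set T})
    (d : T -> nat) (q : T -> rat) :
  (0 < k)%N -> r != v -> d v = 1%N ->
  (forall x, x \notin V -> d x = 0%N) -> (forall x, x \in V -> (0 < d x)%N) ->
  (forall u, u \in V :\ v -> counted (grafted k r v d u) (q u)) ->
  counted (tour k r d) (\sum_(u in V :\ v) q u).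
Proof.
move=> k0 rv dv dV0 dV cq.
have hV u : (u \in enum (V :\ v)) = (u != v) && (0 < d u)%N.
  rewrite mem_enum in_setD1; case: eqP => //= _.
  by apply/idP/idP=> [/dV//|]; apply: contraLR => /dV0 ->.
apply: (@counted_ext _ (fun s => exists2 u, u \in enum (V :\ v) & grafted k r v d u s)).
  move=> s; rewrite (tour_grafted s k0 rv dv).
  by split=> -[u hu g]; exists u => //; move: hu; rewrite hV.
rewrite -big_enum; apply: counted_sum; first exact: enum_uniq.
  by move=> u; rewrite mem_enum; exact: cq.
by move=> u u' s; rewrite !hV => hu hu'; apply: grafted_functional.
Qed.

Lemma tour_nil (T : eqType) (k : nat) (r : T) (d : T -> nat) (s : seq T) :
  (forall x, d x = 0%N) -> tour k r d s <-> s = [::].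
Proof.
move=> d0; split=> [[_ cs _ _]|->].
  case: s cs => // x s /(_ x); by rewrite /= eqxx d0 muln0.
by split=> // x; rewrite d0 muln0.
Qed.

(** A nonempty closed walk at [r] ends with an arrival at [r]. *)
Lemma tour_root (T : eqType) (k : nat) (r : T) (d : T -> nat) (s : seq T) :
  d r = 0%N -> tour k r d s -> s = [::].
Proof.
case: s => // x s dr [ls cs _ _].
have : r \in x :: s by rewrite -[X in X \in _]ls /= mem_last.
by rewrite mem_count cs dr muln0.
Qed.

(** The leaf [v] has weight 1 and only the weight at [u] changes, by [local_weightS] with
    [m = d u - 1]. *)
Lemma prod_local_weight_prune (T : finType) (k : nat) (r u v : T) (V : {set T})
    (d : T -> nat) :
  (0 < k)%N -> r != v -> d v = 1%N -> v \in V -> u \in V :\ v -> (1 < d u)%N ->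
  (\prod_(x in V :\ v) local_weight k (x == r) (prune v d u x))
    * 'C(k * prune v d u u + (u == r) + k - 1, k)%:R
  = (\prod_(x in V) local_weight k (x == r) (d x)) * (d u).-1%:R.
Proof.
move=> k0 rv dv vV uW du.
have uv : u != v by case/setD1P: uW.
have pu : prune v d u u = (d u).-1 by rewrite /prune eqxx (negPf uv) subn1.
have lv : local_weight k (v == r) (d v) = 1.
  by rewrite dv /local_weight eq_sym (negPf rv) /= muln1 fact0 !mulr1 divff // natf_fact.
rewrite [in RHS](big_setD1 v) //= lv mul1r.
rewrite (big_setD1 u) //= [in RHS](big_setD1 u) //= pu.
rewrite mulrAC local_weightS //; last by case: (d u) du => [|[]].
rewrite prednK; last exact: ltnW.
rewrite mulrAC; congr (_ * _ * _); apply: eq_bigr => x.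
by rewrite !in_setD1 /prune => /and3P[/negPf -> /negPf -> _]; rewrite subn0.
Qed.

(* Otherwise deleting [v] would isolate [u], although other vertices remain. *)
Lemma grafted_degree_gt1 (T : finType) (k n : nat) (r u v : T) (V : {set T})
    (d : T -> nat) (s : seq T) :
  (0 < k)%N -> tree_degrees n.+1 V r d -> r != v -> d v = 1%N -> v \in V ->
  u \in V :\ v -> grafted k r v d u s -> (1 < d u)%N.
Proof.
move=> k0 [cV rV dV0 dV sd] rv dv vV uW [s0 t0 i].
have rW : r \in V :\ v by rewrite in_setD1 rv.
have cW : #|V :\ v| = n.+2 by move: cV; rewrite (cardsD1 v) vV => -[].
have uv : u != v by case/setD1P: uW.
have uV : u \in V by case/setD1P: uW.
rewrite ltnNge; apply/negP=> du.
have pu : prune v d u u = 0%N by apply/eqP; rewrite /prune eqxx (negPf uv) subn_eq0.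
(* If [u] is the root, [s0] is empty although a third vertex [w] must still be visited. *)
have [ur|ur] := eqVneq u r.
  have [w] : exists w, w \in (V :\ v) :\ r.
    by apply/set0Pn; rewrite -card_gt0; move: cW; rewrite (cardsD1 r) rW add1n => -[->].
  rewrite !in_setD1 => /and3P[wr wv wV].
  have s0E : s0 = [::] by apply: tour_root t0; rewrite -ur.
  case: t0 => _ /(_ w) + _ _; rewrite s0E /prune ur (negPf wr) (negPf wv) subn0 /=.
  by move=> E; have := muln_gt0 k (d w); rewrite -E k0 dV.
(* Away from the root, [s0] does not visit [u], and the [k] detours have [C(k - 1, k) = 0]
   placements. *)
have : counted (fun s' => ins u v r s' s0 /\ count_mem v s' = k) 0%R.
  have <- : 'C(count_mem u (r :: s0) + k - 1, k)%:R = 0 :> rat.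
    case: t0 => _ /(_ u) + _ _; rewrite pu muln0 /= eq_sym (negPf ur) => ->.
    by rewrite bin_small // subn1 prednK.
  apply: counted_ins => //; case: t0 => _ /(_ v) + _ _.
  by rewrite mem_count /prune dv eqxx addn1 subSS sub0n muln0 => ->.
by move/(@counted0_inv _ _ s).
Qed.

Lemma tree_degrees_prune (T : finType) (n : nat) (r u v : T) (V : {set T})
    (d : T -> nat) :
  tree_degrees n.+1 V r d -> r != v -> d v = 1%N -> v \in V ->
  u \in V :\ v -> (1 < d u)%N -> tree_degrees n (V :\ v) r (prune v d u).
Proof.
move=> [cV rV dV0 dV sd] rv dv vV /setD1P[uv uV] du; split.
- by move: cV; rewrite (cardsD1 v) vV => -[].
- by rewrite in_setD1 rv.
- move=> x; rewrite in_setD1 negb_and negbK /prune => /orP[/eqP->|/dV0->//].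
  by rewrite dv eqxx addn1 subSS.
- move=> x /setD1P[xv xV]; rewrite /prune (negPf xv) addn0.
  by have [->|_] := eqVneq x u; rewrite ?subn_gt0 //; apply: dV.
- have : (\sum_(x in V :\ v) d x = \sum_(x in V :\ v) (prune v d u x + (x == u)))%N.
    apply: eq_bigr => x /setD1P[xv xV].
    by rewrite (pruneE x uv dv (dV u uV)) (negPf xv) addn0.
  rewrite big_split /= [X in (_ + X)%N](bigD1 u) ?in_setD1 ?uv //= eqxx.
  rewrite [X in (_ + (_ + X))%N]big1; last by move=> x /andP[_ /negPf ->].
  by move: sd; rewrite (big_setD1 v) //= dv; lia.
Qed.

(** By induction, attaching the leaf at [u] contributes the product of weights times [n! (d u - 1)].
    The numbers [d u - 1] over the remaining vertices add up to [n + 1], which turns [n!] into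
    [(n + 1)!]. *)
Lemma counted_tours (T : finType) (k n : nat) (r : T) (V : {set T}) (d : T -> nat) :
  (0 < k)%N -> tree_degrees n V r d ->
  counted (tour k r d) (n`!%:R * \prod_(x in V) local_weight k (x == r) (d x)).
Proof.
move=> k0; elim: n V d => [|n IH] V d tV; have [v [vV rv dv]] := leaf_exists tV;
  have [cV rV dV0 dV sd] := tV.
  have cW : #|V :\ v| = 1%N by move: cV; rewrite (cardsD1 v) vV => -[].
  have rW : r \in V :\ v by rewrite in_setD1 rv.
  have WE : V :\ v = [set r].
    by apply/esym/eqP; rewrite eqEcard sub1set rW cards1 cW.
  have dr : d r = 1%N.
    by move: sd; rewrite (big_setD1 v) //= WE big_set1 dv => -[].
  have -> : 0`!%:R * \prod_(x in V) local_weight k (x == r) (d x)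
      = \sum_(u in V :\ v) 1.
    rewrite fact0 mul1r (big_setD1 v) //= WE !big_set1 dv dr eqxx eq_sym (negPf rv).
    by rewrite /local_weight /= !muln1 fact0 !mulr1 expr1 !divff ?mulr1 ?natf_fact.
  apply: (@counted_tour_leaf _ _ _ v V _ (fun=> 1)) => // u; rewrite WE => /set1P ->.
  (* On a single edge the smaller tour is the empty walk, with all detours at its start:
     [C(k, k) = 1]. *)
  have := @counted_grafted T k r v d r 1 rv rv _ dv.
  rewrite /prune eqxx (negPf rv) dr muln0 add0n addKn binn mulr1; apply.
  apply: counted_ext (counted1 [::]) => s; apply: iff_sym; apply: tour_nil => x.
  have [xV|/dV0 ->//] := boolP (x \in V).
  have [->|xv] := eqVneq x v; first by rewrite dv addn1 subSS.
  have /set1P -> : x \in [set r] by rewrite -WE in_setD1 xv.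
  by rewrite eqxx dr.
have cW : #|V :\ v| = n.+2 by move: cV; rewrite (cardsD1 v) vV => -[].
have rW : r \in V :\ v by rewrite in_setD1 rv.
have sW : (\sum_(u in V :\ v) (d u).-1 = n.+1)%N.
  have : (\sum_(u in V :\ v) d u = \sum_(u in V :\ v) ((d u).-1 + 1))%N.
    by apply: eq_bigr => u /setD1P[_ /dV]; rewrite addn1; case: (d u).
  rewrite big_split /= sum_nat_const cW.
  by move: sd; rewrite (big_setD1 v) //= dv; lia.
set Z := \prod_(x in V) _.
have -> : n.+1`!%:R * Z = \sum_(u in V :\ v) (n`!%:R * Z * (d u).-1%:R).
  by rewrite -mulr_sumr -natr_sum sW factS natrM; ring.
apply: (@counted_tour_leaf _ _ _ v V) => // u uW.
have uv : u != v by case/setD1P: uW.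
have uV : u \in V by case/setD1P: uW.
(* For [d u = 1] both sides vanish: the factor [d u - 1] and the set of grafted tours. *)
have [du|du] := ltnP 1 (d u); last first.
  have du1 : d u = 1%N by apply/eqP; rewrite eqn_leq du dV.
  rewrite du1 mulr0; apply: counted0 => s g.
  by have := grafted_degree_gt1 k0 tV rv dv vV uW g; rewrite du1.
rewrite -mulrA -(prod_local_weight_prune k0 rv dv vV uW du) mulrA.
apply: counted_grafted => //; apply: IH; exact: tree_degrees_prune.
Qed.

(** A leaf has a single neighbour and lies on no cycle, so a cycle survives the deletion of leaves
    until two vertices are left, too few for it. *)
Lemma tour_acyclic (T : finType) (k n : nat) (r : T) (V : {set T}) (d : T -> nat)
    (s c : seq T) :
  (0 < k)%N -> tree_degrees n V r d -> tour k r d s -> uniq c -> (3 <= size c)%N ->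
  ~~ path.cycle (fun x y => (x, y) \in steps r s) c.
Proof.
move=> k0; elim: n V d s => [|n IH] V d s tV ts uc c3; apply/negP => cc;
  have [cV rV dV0 dV sd] := tV.
  have : (size c <= size (enum V))%N.
    apply: uniq_leq_size => // x /(next_cycle cc)/mem_steps[+ _].
    rewrite mem_enum inE => /predU1P[->//|xs].
    by apply: contraLR xs => /dV0 dx; case: ts => _ + _ _; rewrite mem_count => ->; rewrite dx muln0.
  by rewrite -cardE cV leqNgt c3.
have [v [vV rv dv]] := leaf_exists tV.
have [u [uv du yvP [vyP [s0 i]]]] := tour_leaf k0 rv dv ts.
have cv : count_mem v s = k by case: ts => _ -> _ _; rewrite dv muln1.
have uW : u \in V :\ v by rewrite in_setD1 uv; apply: contraLR du => /dV0 ->.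
have t0 := (ins_tour k0 uv rv (fun x => pruneE x uv dv du) i cv).1 ts.
have du1 : (1 < d u)%N.
  by apply: (@grafted_degree_gt1 _ k n r u v V d s) => //; exists s0.
have /negP := IH _ _ _ (tree_degrees_prune tV rv dv vV uW du1) t0 uc c3; apply.
have [vc|vc] := boolP (v \in c).
  (* Rotated to start at [v], the cycle would contain [u] twice, after [v] and before it. *)
  exfalso; have [j c' E] := rot_to vc.
  move: cc uc c3; rewrite -(rot_cycle j) -(rot_uniq j) -(size_rot j) E.
  case: c' E => // y [//|z c''] _ /= /andP[/vyP -> ]; rewrite rcons_path.
  move=> /and3P[_ _ /yvP E] /andP[_ /andP[]].
  by rewrite -E mem_last.
apply: sub_in_cycle cc; last by apply/allP => x; exact: (memPn vc).
move=> x y xv yv; rewrite !mem_count (ins_steps _ _ uv i) !xpair_eqE.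
by rewrite (negPf xv) (negPf yv) andbF addn0.
Qed.

(** * Grouping degree sequences *)

(** Induction on the length by the first letter: words starting with [i] make up a share of the
    multinomial coefficient proportional to [t i]. *)
Lemma counted_words (I : finType) (t : I -> nat) :
  counted (fun s : seq I => forall j, count_mem j s = t j)
    ((\sum_j t j)%N`!%:R / \prod_j (t j)`!%:R).
Proof.
have [n sn] : exists n, (\sum_j t j)%N = n by exists (\sum_j t j)%N.
elim: n t sn => [|n IH] t sn.
  have t0 j : t j = 0%N by move/eqP: sn; rewrite sum_nat_eq0 => /forallP/(_ j)/eqP.
  rewrite sn big1 ?divr1; last by move=> j _; rewrite t0.
  apply: counted_ext (counted1 [::]) => s; split=> [-> j|]; first by rewrite t0.
  by case: s => // x s /(_ x); rewrite /= eqxx t0.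
pose t' (i j : I) := (t j - (i == j))%N.
have t'E i j : (0 < t i)%N -> t j = (t' i j + (i == j))%N.
  by rewrite /t'; have [->|_] := eqVneq i j => ti; rewrite subnK.
have st' i : (0 < t i)%N -> (\sum_j t' i j = n)%N.
  move=> ti; move: sn; rewrite (eq_bigr _ (fun j _ => t'E i j ti)) big_split /=.
  rewrite [X in (_ + X)%N](bigD1 i) //= eqxx [X in (_ + (_ + X))%N]big1 ?addn1; first by case.
  by move=> j /negPf; rewrite eq_sym => ->.
have -> : (\sum_j t j)%N`!%:R / \prod_j (t j)`!%:R
    = \sum_(i <- [seq i <- enum I | (0 < t i)%N]) n`!%:R / \prod_j (t' i j)`!%:R :> rat.
  transitivity (\sum_i ((t i)%:R * (n`!%:R / \prod_j (t j)`!%:R)) : rat).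
    by rewrite -mulr_suml -natr_sum sn factS natrM mulrA.
  rewrite big_filter big_enum_cond [RHS]big_mkcond /=; apply: eq_bigr => i _.
  case: ltnP => [ti|]; last by rewrite leqn0 => /eqP ->; rewrite mul0r.
  rewrite (bigD1 i) //= [in RHS](bigD1 i) //=.
  have -> : \prod_(j | j != i) (t' i j)`!%:R = \prod_(j | j != i) (t j)`!%:R :> rat.
    by apply: eq_bigr => j /negPf ji; rewrite /t' eq_sym ji subn0.
  have -> : t' i i = (t i).-1 by rewrite /t' eqxx subn1.
  case: (t i) ti => // m _; rewrite factS natrM /=.
  have : \prod_(j | j != i) (t j)`!%:R != 0 :> rat.
    by apply/prodf_neq0 => j _; exact: natf_fact.
  have := natf_fact m; have : m.+1%:R != 0 :> rat by rewrite pnatr_eq0.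
  move: (m.+1%:R : rat) => c c0 nm p0; field.
  by rewrite c0 nm p0.
apply: (@counted_ext _ (fun s => exists2 i, i \in [seq i <- enum I | (0 < t i)%N]
    & exists2 s', forall j, count_mem j s' = t' i j & s = i :: s')).
  move=> s; split=> [[i]|].
    rewrite mem_filter => /andP[ti _] [s' cs' ->] j.
    by rewrite /= cs' (t'E i) // addnC.
  case: s => [|i s] cs.
    have := sn; rewrite big1 // => j _; by rewrite -cs.
  exists i; first by rewrite mem_filter mem_enum andbT -cs /= eqxx.
  by exists s => // j; rewrite /t' -cs /= addKn.
apply: counted_sum; first by rewrite filter_uniq // enum_uniq.
  move=> i; rewrite mem_filter => /andP[ti _].
  apply: counted_image; first by move=> a b _ _ [].
  by have := IH (t' i) (st' i ti); rewrite st'.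
by move=> i j s _ _ [s1 _ ->] [s2 _ []].
Qed.

Lemma sum_count_mem (I : finType) (s : seq I) : (\sum_j count_mem j s = size s)%N.
Proof.
elim: s => [|i s IH] /=; first by rewrite big1.
by rewrite big_split /= IH (bigD1 i) //= eqxx big1 // => j /negPf; rewrite eq_sym => ->.
Qed.

(** A function on ['I_n] is the word of its values, and its fibre sizes are the letter counts. *)
Lemma card_ffun_fibers (I : finType) (n : nat) (t : I -> nat) :
  (\sum_j t j = n)%N ->
  (#|[set f : {ffun 'I_n -> I} | [forall j, #|[set v | f v == j]| == t j]]|)%:R
  = n`!%:R / \prod_j (t j)`!%:R :> rat.
Proof.
move=> sn; have := counted_words t; rewrite sn; apply: counted_inj.
have cE (f : {ffun 'I_n -> I}) j : count_mem j (codom f) = #|[set v | f v == j]|.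
  rewrite codomE count_map -sum1_count big_enum_cond -sum1_card.
  by apply: eq_bigl => v; rewrite !inE.
set A := [set f | _].
apply: counted_ext (counted_image (f := fun f : {ffun 'I_n -> I} => codom f) _ (counted_card A)).
  move=> s; split=> [[f fA ->] j|cs].
    by move: fA; rewrite inE => /forallP/(_ j)/eqP <-; rewrite cE.
  have ss : size s == n by rewrite -sum_count_mem -sn (eq_bigr _ (fun j _ => cs j)).
  have sE : codom [ffun v => tnth (Tuple ss) v] = s.
    rewrite codomE (eq_map (ffunE _)) -[RHS]/(tval (Tuple ss)).
    by rewrite -[in RHS](map_tnth_enum (Tuple ss)).
  exists [ffun v => tnth (Tuple ss) v]; last by rewrite sE.
  by rewrite inE; apply/forallP => j; rewrite -cE sE cs.
by move=> f g _ _; rewrite !codom_ffun => /val_inj/(can_inj (@fgraphK _ _)).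
Qed.

(** Splitting off the factor [k (i + 1)] from the factorial turns [(k - 1)! i!] in the denominator
    into [k! (i + 1)!]. *)
Lemma local_weight_nonroot (k i : nat) : (0 < k)%N ->
  local_weight k false i.+1 = (i.+1)`!%:R^-1 * ((i.+1 * k)`!)%:R / ((k`!)%:R ^+ i.+1).
Proof.
case: k => // k _; rewrite /local_weight /= [(i.+1 * _)%N]mulnC.
have -> : (k.+1 * i.+1)`!%:R = k.+1%:R * i.+1%:R * ((k.+1 * i.+1).-1)`!%:R :> rat.
  by rewrite -!natrM -factS.
rewrite exprS; have := expf_neq0 i (natf_fact k.+1); move: (_ ^+ i) => e e0.
rewrite !(factS i, factS k) !natrM; have := natf_fact k; have := natf_fact i.
have : k.+1%:R != 0 :> rat by rewrite pnatr_eq0.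
have : i.+1%:R != 0 :> rat by rewrite pnatr_eq0.
move: (i.+1%:R : rat) (k.+1%:R : rat) => c c' c0 c'0 ni nk.
by field; rewrite c0 c'0 e0 ni nk.
Qed.

(* The tuple (n_0, ..., n_(n-1)) counting the vertices with i children. *)
Definition ffun_type (n : nat) (f : {ffun 'I_n -> 'I_n}) : {ffun 'I_n -> 'I_n.+1} :=
  [ffun j => inord #|[set v | f v == j]|].

Lemma ffun_typeE (n : nat) (f : {ffun 'I_n -> 'I_n}) (j : 'I_n) :
  ffun_type f j = #|[set v | f v == j]| :> nat.
Proof. by rewrite ffunE inordK // ltnS -[leqRHS](card_ord n) max_card. Qed.

Lemma ffun_type_sum (n : nat) (f : {ffun 'I_n -> 'I_n}) :
  (\sum_j ffun_type f j = n)%N.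
Proof.
rewrite -[RHS](card_ord n) -sum1_card [RHS](partition_big f xpredT) //=.
apply: eq_bigr => j _; rewrite ffun_typeE -sum1_card.
by apply: eq_bigl => v; rewrite inE.
Qed.

Lemma ffun_type_wsum (n : nat) (f : {ffun 'I_n -> 'I_n}) :
  (\sum_(j < n) j * ffun_type f j = \sum_v f v)%N.
Proof.
rewrite [RHS](partition_big f xpredT) //=.
apply: eq_bigr => j _; rewrite ffun_typeE mulnC -sum_nat_const.
by apply: eq_big => [v|v]; rewrite inE // => /eqP ->.
Qed.

Lemma ffun_type_prod (n : nat) (f : {ffun 'I_n -> 'I_n}) (w : nat -> rat) :
  \prod_v w (f v) = \prod_(j < n) w j ^+ ffun_type f j.
Proof.
rewrite (partition_big f xpredT) //=.
apply: eq_bigr => j _; rewrite ffun_typeE -prodr_const.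
by apply: eq_big => [v|v]; rewrite ?inE // => /eqP ->.
Qed.

(** Here [f] gives the numbers of children of the non-root vertices, [l.+1] that of the root. The
    multinomial coefficient counts the [f] of a given type, and [n! (l + 1) / (n (l + 1)!) = (n -
    1)! / l!] supplies the factorial in the root weight. *)
Lemma rhsE (k n : nat) : (0 < k)%N -> (0 < n)%N ->
  n`!%:R * rhs k n =
  \sum_(l < n) \sum_(f : {ffun 'I_n -> 'I_n} | (\sum_v f v == n - l.+1)%N)
    (n.-1)`!%:R * (local_weight k true l.+1 * \prod_v local_weight k false (f v).+1).
Proof.
move=> k0 n0; rewrite /rhs big_add1 big_mkord mulr_sumr; apply: eq_bigr => l _.
rewrite (partition_big (@ffun_type n) (fun t => t \in Tset n l.+1)); last first.
  by move=> f sf; rewrite inE ffun_type_sum ffun_type_wsum eqxx.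
rewrite mulr_sumr; apply: eq_bigr => t; rewrite inE => /andP[/eqP st /eqP wt].
pose w i := local_weight k false i.+1.
(* Leaves have weight 1, so the product over [i >= 1] may include [i = 0]. *)
have w0 : w 0%N = 1 by rewrite /w local_weight_nonroot // mul1n expr1 invr1 mul1r divff // natf_fact.
rewrite [RHS](eq_bigr (fun _ => (n.-1)`!%:R * (local_weight k true l.+1 * \prod_(j < n) w j ^+ t j))); last first.
  by move=> f /andP[_ /eqP <-]; rewrite (ffun_type_prod f w).
rewrite [RHS](eq_bigl [in [set f : {ffun 'I_n -> 'I_n} | [forall j, #|[set v | f v == j]| == t j]]]); last first.
  move=> f; rewrite !inE; apply/andP/forallP => [[_ /eqP <-] j|tf].
    by rewrite ffun_typeE.
  have ft : ffun_type f = t.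
    by apply/ffunP => j; apply/val_inj/eqP; rewrite /= ffun_typeE; exact: tf.
  by rewrite ft -wt -ft ffun_type_wsum.
have /= cf := card_ffun_fibers st.
rewrite sumr_const -[RHS]mulr_natl cf /multinom.
have -> : \prod_(i < n | (1 <= i)%N) ((i.+1)`!%:R^-1 * ((i.+1 * k)`!)%:R / k`!%:R ^+ i.+1) ^+ t i
    = \prod_(j < n) w j ^+ t j.
  rewrite big_mkcond; apply: eq_bigr => j _ /=; rewrite -local_weight_nonroot //.
  by case: ifP => // /negbT; rewrite -eqn0Ngt => /eqP ->; rewrite w0 expr1n.
move: (\prod_(j < n) w j ^+ t j) => p.
have : \prod_(j < n) (t j)`!%:R != 0 :> rat.
  by apply/prodf_neq0 => j _; exact: natf_fact.
rewrite /local_weight [(k * _)%N]mulnC /= [(l.+1)`!]factS natrM.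
move: (\prod_(j < n) (t j)`!%:R) (natf_fact l) (expf_neq0 l.+1 (natf_fact k)) => q nl.
move: (_ ^+ l.+1) => e e0 q0.
have : l.+1%:R != 0 :> rat by rewrite pnatr_eq0.
have : n%:R != 0 :> rat by rewrite pnatr_eq0 -lt0n.
have -> : n`!%:R = n%:R * (n.-1)`!%:R :> rat by rewrite -natrM -{1 2}(prednK n0) factS.
move: (n%:R : rat) (l.+1%:R : rat) => c c' c0 c'0; field.
by rewrite c0 c'0 q0 e0 nl.
Qed.

Local Close Scope ring_scope.

(** * Closed walks as sequences *)

(** Shifted by one position to fit the encoding by [steps]: the start is omitted and the closing
    return comes last. *)
Definition arrivals {T : Type} {m : nat} (W : {ffun 'I_m -> T}) : seq T :=
  [seq W (ordS i) | i <- enum 'I_m].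

Lemma arrivalsE (T : Type) (m : nat) (W : {ffun 'I_m.+1 -> T}) :
  arrivals W = rcons [seq W (lift ord0 i) | i <- enum 'I_m] (W ord0).
Proof.
rewrite /arrivals enum_ordSr map_rcons -map_comp; congr (rcons _ (W _)).
  apply: eq_map => i /=; congr (W _); apply: val_inj => /=.
  by rewrite modn_small ?ltnS.
by apply: val_inj; rewrite /= modnn.
Qed.

Lemma codomSE (T : Type) (m : nat) (W : {ffun 'I_m.+1 -> T}) :
  codom W = W ord0 :: [seq W (lift ord0 i) | i <- enum 'I_m].
Proof. by rewrite codomE enum_ordSl /= -map_comp. Qed.

Lemma stepsE (T : Type) (x : T) (s : seq T) : steps x s = zip (belast x s) s.
Proof. by elim: s x => // y s IH x; rewrite /steps /= -/(steps y s) IH. Qed.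

Lemma last_arrivals (T : Type) (m : nat) (W : {ffun 'I_m -> T}) (r : T) (h : 0 < m) :
  W (Ordinal h) = r -> last r (arrivals W) = r.
Proof.
case: m W h => // m W h; rewrite arrivalsE last_rcons => <-; congr (W _).
exact: val_inj.
Qed.

Lemma steps_arrivals (T : Type) (m : nat) (W : {ffun 'I_m -> T}) (r : T) (h : 0 < m) :
  W (Ordinal h) = r ->
  steps r (arrivals W) = [seq (W i, W (ordS i)) | i <- enum 'I_m].
Proof.
case: m W h => // m W h; have -> : Ordinal h = ord0 by exact: val_inj.
by move=> Wr; rewrite stepsE {1}arrivalsE belast_rcons -Wr -codomSE codomE zip_map.
Qed.

Lemma mem_arrivals (T : eqType) (m : nat) (W : {ffun 'I_m -> T}) : arrivals W =i codom W.
Proof.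
case: m W => [|m] W x; first by rewrite /arrivals codomE; case: (enum _) => [|[]].
by rewrite arrivalsE codomSE mem_rcons.
Qed.

Lemma arrivals_inj (T : Type) (m : nat) : injective (@arrivals T m).
Proof.
case: m => [|m] W W'; first by move=> _; apply/ffunP => -[].
rewrite !arrivalsE => /rcons_inj[E0 E1]; apply/ffunP => i.
case: (unliftP ord0 i) => [j|] -> //.
by move/eq_in_map: E0 => /(_ j); rewrite mem_enum; exact.
Qed.

Lemma arrivals_surj (T : Type) (m : nat) (r : T) (h : 0 < m) (s : seq T) :
  size s = m -> last r s = r ->
  exists2 W : {ffun 'I_m -> T}, W (Ordinal h) = r & arrivals W = s.
Proof.
case: m h => // m h; case/lastP: s => // s x; rewrite size_rcons last_rcons => -[sm] xr.
(* The final return to [r] is moved to the front, as position 0. *)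
exists [ffun i : 'I_m.+1 => nth r (r :: s) i]; first by rewrite ffunE.
rewrite arrivalsE ffunE /= xr; congr rcons.
transitivity [seq nth r s i | i <- [seq val i | i <- enum 'I_m]].
  by rewrite -map_comp; apply: eq_map => i; rewrite /= ffunE.
by rewrite val_enum_ord -[RHS](mkseq_nth r) sm.
Qed.

Lemma count_map_enum (I : finType) (T : eqType) (f : I -> T) (x : T) :
  count_mem x [seq f i | i <- enum I] = #|[set i | f i == x]|.
Proof.
rewrite count_map -sum1_count big_enum_cond -sum1_card.
by apply: eq_bigl => v; rewrite !inE.
Qed.

Lemma traversalsE (m N : nat) (W : {ffun 'I_m -> 'I_N}) (r x y : 'I_N) (h : 0 < m) :
  W (Ordinal h) = r -> traversals W x y = count_mem (x, y) (steps r (arrivals W)).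
Proof.
move=> Wr; rewrite (steps_arrivals Wr) count_map_enum.
by apply: eq_card => i; rewrite !inE.
Qed.

Lemma walk_adjE (m N : nat) (W : {ffun 'I_m -> 'I_N}) (r x y : 'I_N) (h : 0 < m) :
  W (Ordinal h) = r ->
  walk_adj W x y = ((x, y) \in steps r (arrivals W)) || ((y, x) \in steps r (arrivals W)).
Proof.
move=> Wr; rewrite (steps_arrivals Wr); apply/existsP/orP.
  by move=> [i /orP[]/andP[/eqP <- /eqP <-]]; [left|right]; apply: map_f; rewrite mem_enum.
by case=> /mapP[i _ [-> ->]]; exists i; rewrite !eqxx ?orbT.
Qed.

(** * Degree sequences of closed walks *)

(* [p] holds the number of children of the root, minus one, and those of the other
   vertices. *)
Definition vertex_degree {n : nat} (p : 'I_n * {ffun 'I_n -> 'I_n}) (x : 'I_n.+1) : nat :=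
  if unlift ord0 x is Some v then (p.2 v).+1 else p.1.+1.

(** Each of the [n] non-root vertices is a child exactly once, [p.1.+1] times of the root. As
    [p.1 < n], the subtraction is exact. *)
Definition balanced {n : nat} (p : 'I_n * {ffun 'I_n -> 'I_n}) : bool :=
  (\sum_v p.2 v == n - p.1.+1)%N.

Lemma vertex_degree0 (n : nat) (p : 'I_n * {ffun 'I_n -> 'I_n}) :
  vertex_degree p ord0 = p.1.+1.
Proof. by rewrite /vertex_degree unlift_none. Qed.

Lemma vertex_degree_lift (n : nat) (p : 'I_n * {ffun 'I_n -> 'I_n}) (v : 'I_n) :
  vertex_degree p (lift ord0 v) = (p.2 v).+1.
Proof. by rewrite /vertex_degree liftK. Qed.

Lemma vertex_degree_gt0 (n : nat) (p : 'I_n * {ffun 'I_n -> 'I_n}) x :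
  0 < vertex_degree p x.
Proof. by rewrite /vertex_degree; case: unlift. Qed.

Lemma balancedE (n : nat) (p : 'I_n * {ffun 'I_n -> 'I_n}) :
  balanced p = (\sum_x vertex_degree p x == 2 * n).
Proof.
rewrite /balanced big_ord_recl vertex_degree0.
under [in RHS]eq_bigr do rewrite vertex_degree_lift -addn1.
rewrite big_split /= sum_nat_const card_ord muln1.
case: p => l f /=; have := ltn_ord l; lia.
Qed.

Lemma vertex_degree_inj (n : nat) (p p' : 'I_n * {ffun 'I_n -> 'I_n}) :
  vertex_degree p =1 vertex_degree p' -> p = p'.
Proof.
case: p p' => [l f] [l' f'] E.
have /= := E ord0; rewrite !vertex_degree0 => -[/val_inj ->]; congr pair.
apply/ffunP => v; have /= := E (lift ord0 v).
by rewrite !vertex_degree_lift => -[/val_inj].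
Qed.

Lemma vertex_degree_surj (n : nat) (d : 'I_n.+1 -> nat) :
  (forall x, 0 < d x) -> \sum_x d x = 2 * n ->
  exists2 p, balanced p & vertex_degree p =1 d.
Proof.
move=> d0 sd.
(* The other [n] vertices use up at least [n] of the total [2 * n]; hence [d x - 1] fits into
   ['I_n]. *)
have dn x : d x <= n.
  move: sd; rewrite (bigD1 x) //=.
  have : \sum_(i | i != x) 1 <= \sum_(i | i != x) d i by apply: leq_sum.
  rewrite sum1dep_card (cardsE (predC1 x)) cardC1 card_ord.
  move: (\sum_(i | i != x) d i) => S; lia.
have dP x : (d x).-1 < n by have := dn x; have := d0 x; lia.
have pd : vertex_degree (Ordinal (dP ord0), [ffun v => Ordinal (dP (lift ord0 v))]) =1 d.
  move=> x; case: (unliftP ord0 x) => [v|] ->.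
    by rewrite vertex_degree_lift ffunE /= prednK.
  by rewrite vertex_degree0 /= prednK.
eexists; last exact: pd.
by rewrite balancedE (eq_bigr _ (fun x _ => pd x)) sd.
Qed.

Lemma tree_degrees_balanced (n : nat) (p : 'I_n.+1 * {ffun 'I_n.+1 -> 'I_n.+1}) :
  balanced p -> tree_degrees n [set: 'I_n.+2] ord0 (vertex_degree p).
Proof.
rewrite balancedE => /eqP sp; split; rewrite ?cardsT ?card_ord ?inE //.
- by move=> x; rewrite inE.
- by move=> x _; apply: vertex_degree_gt0.
- by rewrite -sp; apply: eq_bigl => x; rewrite inE.
Qed.

Definition closed_tour (k n : nat) (W : {ffun 'I_(2 * k * n) -> 'I_n.+1}) : Prop :=
  [/\ forall i, W i != W (ordS i),
      exists h : 0 < 2 * k * n, W (Ordinal h) = ord0,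
      forall j, j \in fgraph W
    & forall x y, walk_adj W x y -> traversals W x y = k /\ traversals W y x = k].

Lemma sum_count_pair (T : finType) (s : seq (T * T)) (x : T) :
  \sum_y count_mem (y, x) s = count (fun p => p.2 == x) s.
Proof.
elim: s => [|[a b] s IH] /=; first by rewrite big1.
rewrite big_split /= IH (bigD1 a) //= xpair_eqE eqxx big1 ?addn0 // => y.
by rewrite xpair_eqE eq_sym => /negPf ->.
Qed.

(** The degree of [x] is the number of vertices from which [x] is entered, each accounting for [k]
    arrivals. The [2 * k * n] arrivals in total then give the degree sum [2 * n]. *)
Lemma closed_tourP (k n : nat) (W : {ffun 'I_(2 * k * n) -> 'I_n.+1}) :
  0 < k ->
  closed_tour W <-> (exists h : 0 < 2 * k * n, W (Ordinal h) = ord0) /\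
    exists2 p, balanced p & tour k ord0 (vertex_degree p) (arrivals W).
Proof.
move=> k0; split=> [[nl [h W0] cov sy]|[[h W0] [p bp [ls cs nl sy]]]].
  have mem_st x y : (x, y) \in steps ord0 (arrivals W) ->
      count_mem (x, y) (steps ord0 (arrivals W)) = k /\
      count_mem (y, x) (steps ord0 (arrivals W)) = k.
    by move=> xy; rewrite -!(traversalsE _ _ W0); apply: sy; rewrite (walk_adjE _ _ W0) xy.
  pose d x := #|[set y | (y, x) \in steps ord0 (arrivals W)]|.
  have cd x : count_mem x (arrivals W) = k * d x.
    rewrite (count_steps2 ord0) -sum_count_pair [RHS]mulnC -sum_nat_const [RHS]big_mkcond /=.
    apply: eq_bigr => y _; rewrite inE; case: ifP => [/mem_st[]//|].
    by rewrite mem_count lt0n => /negbFE/eqP.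
  have d0 x : 0 < d x.
    have : x \in arrivals W by rewrite mem_arrivals codom_ffun cov.
    by rewrite mem_count cd muln_gt0 => /andP[].
  have [|p bp pd] := @vertex_degree_surj n d d0.
    apply/eqP; rewrite -(eqn_pmul2l k0) big_distrr /=; apply/eqP.
    rewrite -(eq_bigr _ (fun x _ => cd x)) sum_count_mem size_map size_enum_ord; lia.
  split; first by exists h.
  exists p => //; split=> //; first exact: last_arrivals W0.
  - by move=> x; rewrite pd cd.
  - move=> x; rewrite (steps_arrivals W0); apply/mapP => -[i _ [-> E]].
    by have := nl i; rewrite -E eqxx.
have covW x : x \in arrivals W by rewrite mem_count cs muln_gt0 k0 vertex_degree_gt0.
split; last 1 first.
- move=> x y; rewrite (walk_adjE _ _ W0) !(traversalsE _ _ W0).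
  by case/orP=> /sy[].
- move=> i; apply/negP => /eqP E; have := nl (W i).
  rewrite {2}E (steps_arrivals W0) => /negP; apply.
  by apply: map_f; rewrite mem_enum.
- by exists h.
- by move=> j; have := covW j; rewrite mem_arrivals codom_ffun.
Qed.

Definition closed_tours (k n : nat) : {set {ffun 'I_(2 * k * n) -> 'I_n.+1}} :=
  [set W | `[< closed_tour W >]].

Local Open Scope ring_scope.

(** Both sides count the arrival lists of closed tours, the right one sorted by degree sequence. The
    visit counts determine the degrees since [k] is positive, so nothing is counted twice. *)
Lemma card_closed_tours (k n : nat) : (0 < k)%N -> (0 < n)%N ->
  #|closed_tours k n|%:R = n`!%:R * rhs k n.
Proof.
move=> k0 n0; rewrite rhsE // pair_big_dep /=.
apply: (@counted_inj _ (fun s : seq 'I_n.+1 => exists2 p, p \in enum (@balanced n) &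
    tour k ord0 (vertex_degree p) s)).
  have cX := counted_card (closed_tours k n).
  apply: counted_ext (counted_image (f := @arrivals _ _) _ cX); last first.
    by move=> W W' _ _; apply: arrivals_inj.
  move=> s; split=> [[W + ->]|[p]].
    by rewrite inE => /asboolP/(closed_tourP _ k0)[_ [p bp tp]]; exists p; rewrite ?mem_enum.
  rewrite mem_enum => bp tp; have [ls cs _ _] := tp.
  have h : (0 < 2 * k * n)%N by lia.
  have [|W W0 E] := arrivals_surj h _ ls.
    rewrite -sum_count_mem (eq_bigr _ (fun x _ => cs x)) -big_distrr /=.
    by move: bp; rewrite -topredE /= balancedE => /eqP ->; lia.
  exists W => //; rewrite inE; apply/asboolP/(closed_tourP _ k0).
  by split; [exists h|exists p; rewrite ?E].
case: n n0 => // n _.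
rewrite (eq_bigl (@balanced n.+1)) //.
rewrite -[in X in counted _ X]big_enum; apply: counted_sum; first exact: enum_uniq.
  move=> p; rewrite mem_enum => bp.
  have := counted_tours k0 (tree_degrees_balanced bp).
  rewrite (eq_bigl xpredT); last by move=> x; rewrite inE.
  rewrite big_ord_recl vertex_degree0 eqxx.
  rewrite (eq_bigr (fun v => local_weight k false (p.2 v).+1)) // => v _.
  by rewrite vertex_degree_lift.
move=> p p' s _ _ [_ cs _ _] [_ cs' _ _]; apply: vertex_degree_inj => x.
by apply/eqP; rewrite -(eqn_pmul2l k0) -cs cs'.
Qed.

(** * The tree condition *)

Lemma path_steps (T : eqType) (x : T) (s : seq T) (l : seq (T * T)) :
  {subset steps x s <= l} -> path (fun a b => (a, b) \in l) x s.
Proof.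
elim: s x => // y s IH x sub; rewrite /= sub ?mem_head //=; apply: IH => e es.
by apply: sub; rewrite /steps /= inE es orbT.
Qed.

(** The graph is connected because the walk itself is a path from the root through all vertices;
    [tour_acyclic] excludes cycles. *)
Lemma ktour_closed (k n : nat) (W : {ffun 'I_(2 * k * n) -> 'I_n.+1}) :
  (0 < k)%N -> (0 < n)%N ->
  is_ktour W <-> closed_tour W /\
    forall j j' : 'I_n.+1, (j < j')%N -> (index j (fgraph W) < index j' (fgraph W))%N.
Proof.
move=> k0 n0; split=> [[nl [W0 [cov [ord [_ sy]]]]]|[cW ord]]; first by split.
have [[h W0] [p bp tp]] := (closed_tourP W k0).1 cW.
have [nl hW cov sy] := cW.
have adjE x y : walk_adj W x y = ((x, y) \in steps ord0 (arrivals W)).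
  rewrite (walk_adjE _ _ W0); apply/orP/idP => [[//|]|]; last by left.
  by case: tp => _ _ _ sy' /sy'[_]; rewrite mem_count => ->.
suff tr : is_tree (walk_adj W) by do 5!split=> //.
split; last first.
  case: n n0 W cW ord h W0 p bp tp nl hW cov sy adjE => // n _ W cW ord h W0 p bp tp nl hW cov sy adjE.
  move=> s us s3; rewrite (eq_cycle adjE).
  exact: (tour_acyclic k0 (tree_degrees_balanced bp) tp).
have pW : path (walk_adj W) ord0 (arrivals W).
  by rewrite (eq_path adjE); apply: path_steps.
have sym : connect_sym (walk_adj W).
  by apply: sym_connect_sym => x y; apply: eq_existsb => i; rewrite orbC.
have c0 x : connect (walk_adj W) ord0 x.
  apply: (path_connect pW); rewrite in_cons mem_arrivals.
  by have := cov x; rewrite codom_ffun => ->; rewrite orbT.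
by move=> x y; apply: connect_trans (c0 y); rewrite sym.
Qed.

Local Close Scope ring_scope.

(** * Order of first visits *)

Definition relabel {m : nat} {T : finType} (sigma : {perm T}) (W : {ffun 'I_m -> T}) :
    {ffun 'I_m -> T} := [ffun i => sigma (W i)].

Lemma relabelM (m : nat) (T : finType) (s t : {perm T}) (W : {ffun 'I_m -> T}) :
  relabel t (relabel s W) = relabel (s * t)%g W.
Proof. by apply/ffunP => i; rewrite !ffunE permM. Qed.

Lemma relabel1 (m : nat) (T : finType) (W : {ffun 'I_m -> T}) : relabel 1%g W = W.
Proof. by apply/ffunP => i; rewrite ffunE perm1. Qed.

Lemma fgraph_relabel (m : nat) (T : finType) (s : {perm T}) (W : {ffun 'I_m -> T}) :
  fgraph (relabel s W) = map s (fgraph W) :> seq T.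
Proof.
rewrite -!codom_ffun !codomE -map_comp; apply: eq_map => i.
by rewrite /= ffunE.
Qed.

Lemma traversals_relabel (m N : nat) (s : {perm 'I_N}) (W : {ffun 'I_m -> 'I_N}) x y :
  traversals (relabel s W) (s x) (s y) = traversals W x y.
Proof. by apply: eq_card => i; rewrite !inE !ffunE !(inj_eq perm_inj). Qed.

Lemma walk_adj_relabel (m N : nat) (s : {perm 'I_N}) (W : {ffun 'I_m -> 'I_N}) x y :
  walk_adj (relabel s W) (s x) (s y) = walk_adj W x y.
Proof. by apply: eq_existsb => i; rewrite !ffunE !(inj_eq perm_inj). Qed.

Lemma closed_tour_relabel (k n : nat) (s : {perm 'I_n.+1})
    (W : {ffun 'I_(2 * k * n) -> 'I_n.+1}) :
  s ord0 = ord0 -> closed_tour W -> closed_tour (relabel s W).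
Proof.
move=> s0 [nl [h W0] cov sy]; split.
- by move=> i; rewrite !ffunE (inj_eq perm_inj).
- by exists h; rewrite ffunE W0.
- by move=> j; rewrite memtE fgraph_relabel -(permKV s j) mem_map ?cov //; apply: perm_inj.
- move=> x y; rewrite -(permKV s x) -(permKV s y) walk_adj_relabel !traversals_relabel.
  exact: sy.
Qed.

Definition first_visit_rank {m N : nat} (W : {ffun 'I_m -> 'I_N}) (x : 'I_N) : nat :=
  #|[set y | index y (fgraph W) < index x (fgraph W)]|.

Lemma rank_relabel (m N : nat) (s : {perm 'I_N}) (W : {ffun 'I_m -> 'I_N}) x :
  first_visit_rank (relabel s W) (s x) = first_visit_rank W x.
Proof.
rewrite /first_visit_rank -[RHS](card_imset _ (@perm_inj _ s)).
apply: eq_card => y; rewrite -(permKV s y) (mem_imset _ _ (@perm_inj _ s)) !inE.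
by rewrite fgraph_relabel !index_map //; apply: perm_inj.
Qed.

Lemma rank_ordered (m N : nat) (W : {ffun 'I_m -> 'I_N}) (x : 'I_N) :
  (forall j j' : 'I_N, j < j' -> index j (fgraph W) < index j' (fgraph W)) ->
  first_visit_rank W x = x.
Proof.
move=> ord; rewrite /first_visit_rank.
have -> : [set y | index y (fgraph W) < index x (fgraph W)] = [set y : 'I_N | y < x].
  apply/setP => y; rewrite !inE; apply/idP/idP; last exact: ord.
  apply: contraLR; rewrite -!leqNgt leq_eqVlt => /orP[/eqP/val_inj-> //|/ord].
  exact: ltnW.
by rewrite -sum1dep_card (big_ord_narrow (ltnW (ltn_ord x))) sum1_card card_ord.
Qed.

(** The sets counted by the ranks are nested; if [x] comes first, it belongs to the set of [y] but
    not to its own. *)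
Lemma rank_lt (m N : nat) (W : {ffun 'I_m -> 'I_N}) (x y : 'I_N) :
  (first_visit_rank W x < first_visit_rank W y) =
  (index x (fgraph W) < index y (fgraph W)).
Proof.
apply/idP/idP => [|xy].
  apply: contraTT; rewrite -!leqNgt => yx; apply: subset_leq_card.
  by apply/subsetP => z; rewrite !inE => /leq_trans; apply.
apply: proper_card; apply/properP; split; last by exists x; rewrite !inE ?xy ?ltnn.
by apply/subsetP => z; rewrite !inE => zx; apply: ltn_trans xy.
Qed.

Lemma rank_inj (m N : nat) (W : {ffun 'I_m -> 'I_N}) :
  (forall j, j \in fgraph W) -> injective (first_visit_rank W).
Proof.
move=> cov x y E; have xy : index x (fgraph W) = index y (fgraph W).
  by have := rank_lt W x y; have := rank_lt W y x; rewrite E ltnn; case: ltngtP.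
have := nth_index x (cov x); rewrite xy => <-.
by rewrite nth_index.
Qed.

Lemma rank_ltn (m N : nat) (W : {ffun 'I_m -> 'I_N}) (x : 'I_N) : first_visit_rank W x < N.
Proof.
rewrite -[X in _ < X](card_ord N) -cardsT; apply: proper_card.
by apply/properP; split; [apply: subsetT|exists x; rewrite !inE ?ltnn].
Qed.

(** Relabelling is a bijection from pairs of a permutation fixing the root and a tour onto the
    closed tours. *)
Lemma card_relabellings (k n : nat) : 0 < k -> 0 < n ->
  #|closed_tours k n| = n`! * num_ktours k n.
Proof.
move=> k0 n0; set Y := [set W | `[< @is_ktour k n W >]].
(* Fixing the root is put as moving only the other [n] vertices, the form that [card_perm]
   counts. *)
pose S := [set s : {perm 'I_n.+1} | perm_on [set~ ord0] s].
have SP s : s \in S -> s ord0 = ord0.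
  by rewrite inE => /out_perm; apply; rewrite !inE eqxx.
have -> : n`! = #|S| by rewrite cardsE card_perm cardsC1 card_ord.
rewrite -[num_ktours k n]/#|Y| -cardsX.
rewrite -(card_in_imset (f := fun p => relabel p.1 p.2)); last first.
  move=> [s W] [t V]; rewrite !in_setX /= => /andP[_ +] /andP[_ +] E.
  rewrite !inE => /asboolP/(ktour_closed _ k0 n0)[_ oW] /asboolP/(ktour_closed _ k0 n0)[_ oV].
  (* Since [W] is ordered, [x] has rank [s^-1 x] in [relabel s W], so the relabelled walk determines
     [s]. *)
  have st : s = t.
    apply: (can_inj invgK); apply/permP => x; apply: val_inj.
    transitivity (first_visit_rank (relabel s W) x).
      by rewrite -{2}(permKV s x) rank_relabel rank_ordered.
    by rewrite E -{1}(permKV t x) rank_relabel rank_ordered.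
  congr pair => //; have := congr1 (relabel s^-1) E.
  by rewrite -st !relabelM mulgV !relabel1.
apply: eq_card => V; apply/idP/imsetP => [|[[s W]]]; last first.
  rewrite in_setX /= => /andP[/SP s0 +] ->.
  rewrite inE => /asboolP/(ktour_closed _ k0 n0)[cW _].
  by rewrite inE; apply/asboolP; apply: closed_tour_relabel.
rewrite inE => /asboolP cV; have [_ [h V0] cov _] := cV.
have rI : injective (fun x => Ordinal (rank_ltn V x)).
  by move=> x y /(congr1 val); apply: rank_inj.
(* Replacing every vertex by its rank puts the first visits in order; the root is visited first and
   keeps its label 0. *)
pose r := perm rI.
have r0 : r ord0 = ord0.
  apply: val_inj; rewrite permE /=; apply/eqP; rewrite cards_eq0; apply/eqP/setP => y.
  have -> : index ord0 (fgraph V) = 0.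
    rewrite -codom_ffun; move: V V0 {cV cov rI r}; move: h; case: (2 * k * n) => // m h V V0.
    rewrite codomSE (_ : V ord0 = ord0) /= ?eqxx // -V0; congr (V _); exact: val_inj.
  by rewrite !inE ltn0.
exists (r^-1%g, relabel r V) => /=; last by rewrite relabelM mulgV relabel1.
rewrite in_setX /=; apply/andP; split.
  rewrite inE; apply/subsetP => x; rewrite !inE; apply: contraNN => /eqP ->.
  by rewrite -{1}r0 permK.
rewrite inE; apply/asboolP/(ktour_closed _ k0 n0); split; first exact: closed_tour_relabel.
move=> j j'; rewrite -(permKV r j) -(permKV r j'); move: (_ j) (_ j') => x x'.
rewrite fgraph_relabel !index_map; try exact: perm_inj.
by rewrite -rank_lt !permE.
Qed.

Theorem theorem2 (k n : nat) (hk : (1 <= k)%N) (hn : (1 <= n)%N) :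
  ((num_ktours k n)%:R : rat) = rhs k n.
Proof.
apply: (mulfI (natf_fact n)).
by rewrite -card_closed_tours // card_relabellings // natrM.
Qed.
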